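(* Let $M$ be an oriented matroid of rank $r$ on a finite ground set $E$, with set of covectors $\mathcal{L}$, and let $N$ be an extension of $M$ by a generic element $g\notin E$. Let $T_1,\dots,T_m$ be the bounded topes of $M$ with respect to $g$ (their number is $m=|\mu(M)|$). For each $i$, let $\mathcal{B}^+_{T_i}(M)$ be the positive Bergman complex of the reorientation of $M$ in which $T_i$ becomes the all-positive tope. Then $\mathcal{B}(\underline{M})=\bigcup_{i=1}^m\mathcal{B}^+_{T_i}(M)$, where $\underline{M}$ is the underlying unoriented matroid.
   Context: An extension $N$ of $M$ by $g$ (covector set $\mathcal{L}_g\subseteq\{+,-,0\}^{E\cup\{g\}}$, deletion of $g$ giving $M$) is generic if $g$ is not in the closure of any $A\subseteq E$ with $\mathrm{rank}(A)<r$. Let $\mathcal{L}_g^+=\{X\in\mathcal{L}_g:X_g=+\}$ and $\mathcal{L}_g^{++}=\{X\in\mathcal{L}_g^+:\text{every covector }Y\le X\text{ of }N\text{ with }Y\neq0\text{ has }Y_g=+\}$ (here $Y\le X$ means $Y_e\in\{0,X_e\}$ for all $e$). The maximal elements of $\mathcal{L}_g^{++}$ are the bounded topes of $N$ with respect to $g$; deleting the $g$-entry of each gives a tope of $M$, and these are the bounded topes of $M$ with respect to $g$. $\mu(M)$ denotes the Möbius function of the lattice of flats of $\underline M$ from its bottom to its top element. Identify $E$ with $[n]$. For $\omega\in\mathbb{R}^n$, $\mathcal{F}(\omega)$ is the unique chain $\emptyset=F_0\subsetneq F_1\subsetneq\cdots\subsetneq F_{k+1}=[n]$ with $\omega$ constant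 on each $F_i\setminus F_{i-1}$ and strictly increasing from block to block. $S^{n-2}=\{\omega:\sum\omega_i=0,\sum\omega_i^2=1\}$. The Bergman complex is $\mathcal{B}(\underline{M})=\{\omega\in S^{n-2}:\mathcal{F}(\omega)\text{ is a flag of flats}\}$. For a tope $T$ of $M$, a flat is positive with respect to $T$ if it is the zero set of a covector $X$ of $M$ with $X\le T$, and $\mathcal{B}^+_T(M)=\{\omega\in S^{n-2}:\mathcal{F}(\omega)\text{ is a flag of flats positive with respect to }T\}$.
   Formalization: The extension N is required to have the same rank as M (g is not a coloop; otherwise the union formula fails), and the count m = |μ(M)| is asserted only for r > 0 (for r = 0 with g a loop there is no bounded tope but |μ(M)| = 1). *)

(* Defs.v *)
From mathcomp Require Import all_boot all_order all_algebra.

Set Implicit Arguments.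
Unset Strict Implicit.
Unset Printing Implicit Defensive.

Import Order.TTheory GRing.Theory Num.Theory.

Section FlatCovers.
Variables (E : finType) (Fl : {set {set E}}).

Definition flat_covers (F G : {set E}) : bool :=
  [&& F \in Fl, G \in Fl, F \proper G &
      [forall H in Fl, ~~ ((F \proper H) && (H \proper G))]].

End FlatCovers.

Record matroid (E : finType) := Matroid {
  flats : {set {set E}};
  flatsT : [set: E] \in flats;
  flatsI : forall F G, F \in flats -> G \in flats -> F :&: G \in flats;
  flats_cover : forall F e, F \in flats -> e \notin F ->
    exists! G : {set E}, flat_covers flats F G /\ e \in G
}.

Section MatroidTheory.
Variables (E : finType) (M : matroid E).
Implicit Types (A F G H : {set E}).

Definition closure A : {set E} := \bigcap_(F in flats M | A \subset F) F.

Definition indep A : bool := [forall a in A, a \notin closure (A :\ a)].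

Definition rank_of A : nat :=
  \max_(I : {set E} | (I \subset A) && indep I) #|I|.

Definition rank : nat := rank_of [set: E].

(* The usual recursion mu(F,F) = 1, mu(F,G) = - sum_(F <= H < G) mu(F,H) on the
   lattice of flats, made structural by a bound k > #|G|; see [mobiusE]. *)
Fixpoint mobius_rec (k : nat) F G : int :=
  if k isn't k'.+1 then 0%R else
  if F == G then 1%R else
  if F \proper G then
    (- \sum_(H in flats M | (F \subset H) && (H \proper G))
         mobius_rec k' F H)%R
  else 0%R.

Definition mobius F G : int := mobius_rec #|G|.+1 F G.

Lemma mobius_rec_bound k F G : #|G| < k -> mobius_rec k F G = mobius F G.
Proof.
rewrite /mobius.
suff H j : #|G| < k -> #|G| < j -> mobius_rec k F G = mobius_rec j F G.
  by move=> ?; apply: H.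
elim: k j G => [|k IHk] [|j] G //= ltGk ltGj.
case: eqP => // _; case: ifP => // _; congr (- _)%R.
apply: eq_bigr => H /andP[_ /andP[_ /proper_card ltHG]].
by apply: IHk; apply: leq_trans ltHG _.
Qed.

Lemma mobiusE F G :
  mobius F G = if F == G then 1%R else
               if F \proper G then
                 (- \sum_(H in flats M | (F \subset H) && (H \proper G))
                      mobius F H)%R
               else 0%R.
Proof.
rewrite {1}/mobius /=; case: eqP => // _; case: ifP => // _; congr (- _)%R.
apply: eq_bigr => H /andP[_ /andP[_ /proper_card ltHG]].
exact: mobius_rec_bound.
Qed.

Definition mu : int := mobius (closure set0) [set: E].

End MatroidTheory.

(* [None] is 0, [Some true] is + and [Some false] is -. *)
Definition sign : Type := option bool.
Definition sg_zero : sign := None.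
Definition sg_pos : sign := Some true.
Definition sg_opp (s : sign) : sign := omap negb s.

Notation signvec E := {ffun E -> option bool}.

Section SignVectors.
Variable E : finType.
Implicit Types X Y : signvec E.

Definition sv_zero : signvec E := [ffun _ => sg_zero].
Definition sv_opp X : signvec E := [ffun e => sg_opp (X e)].
Definition sv_comp X Y : signvec E :=
  [ffun e => if X e == sg_zero then Y e else X e].
Definition sv_sep X Y : {set E} :=
  [set e | (X e != sg_zero) && (X e == sg_opp (Y e))].
Definition sv_le Y X : bool := [forall e, (Y e == sg_zero) || (Y e == X e)].
Definition zero_set X : {set E} := [set e | X e == sg_zero].

End SignVectors.

Record oriented_matroid (E : finType) := OrientedMatroid {
  covectors : {set signvec E};
  covectors0 : sv_zero E \in covectors;
  covectorsN : forall X, X \in covectors -> sv_opp X \in covectors;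
  covectors_comp : forall X Y,
    X \in covectors -> Y \in covectors -> sv_comp X Y \in covectors;
  covectors_elim : forall X Y e,
    X \in covectors -> Y \in covectors -> e \in sv_sep X Y ->
    exists Z, [/\ Z \in covectors, Z e = sg_zero &
                  forall f, f \notin sv_sep X Y -> Z f = sv_comp X Y f]
}.

Section Underlying.
Variables (E : finType) (M : oriented_matroid E).

Definition om_flats : {set {set E}} := [set zero_set X | X in covectors M].

Lemma om_flatsT : [set: E] \in om_flats.
Proof.
apply/imsetP; exists (sv_zero E); first exact: covectors0.
by apply/setP => e; rewrite !inE ffunE eqxx.
Qed.

Lemma om_flatsI F G : F \in om_flats -> G \in om_flats -> F :&: G \in om_flats.
Proof.
move=> /imsetP[X LX ->] /imsetP[Y LY ->]; apply/imsetP.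
exists (sv_comp X Y); first exact: covectors_comp.
by apply/setP => e; rewrite !inE ffunE; case: (X e).
Qed.

Lemma om_flats_exchange F H e f :
  F \in om_flats -> H \in om_flats -> F \subset H ->
  e \notin H -> f \in H -> f \notin F ->
  exists2 G, G \in om_flats & [/\ F \subset G, e \in G & f \notin G].
Proof.
move=> /imsetP[X LX ->] /imsetP[Y LY ->] /subsetP sFH.
rewrite !inE => Ye Yf Xf.
have Xe : X e != sg_zero.
  by apply: contra Ye => Xe; have := sFH e; rewrite !inE; apply.
have [Y' LY' [zY' Y'e]] : exists2 Y', Y' \in covectors M &
    (forall a, (Y' a == sg_zero) = (Y a == sg_zero)) /\ X e = sg_opp (Y' e).
  have [eXY|neXY] := eqVneq (X e) (Y e).
    exists (sv_opp Y); first exact: covectorsN.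
    split=> [a|]; first by rewrite ffunE; case: (Y a).
    by rewrite ffunE eXY; case: (Y e) => [[]|].
  exists Y => //; split=> //.
  by case: (X e) (Y e) Xe Ye neXY => [[]|] [[]|].
have eS : e \in sv_sep X Y' by rewrite inE Xe -Y'e eqxx.
have [Z [LZ Ze ZE]] := covectors_elim LX LY' eS.
exists (zero_set Z); first exact: imset_f.
split; [apply/subsetP => a | by rewrite inE Ze | ].
  rewrite !inE => Xa; rewrite ZE ?inE ?Xa // ffunE Xa zY'.
  by have := sFH a; rewrite !inE; apply.
rewrite inE ZE ?ffunE ?(negbTE Xf) // inE Xf /=.
by move: Yf; rewrite -zY' => /eqP ->.
Qed.

Lemma om_flats_cover F e : F \in om_flats -> e \notin F ->
  exists! G : {set E}, flat_covers om_flats F G /\ e \in G.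
Proof.
move=> FF Fe.
pose G := \bigcap_(H in om_flats | (F \subset H) && (e \in H)) H.
have GF : G \in om_flats.
  rewrite /G; apply: (big_ind (fun H => H \in om_flats)).
  - exact: om_flatsT.
  - exact: om_flatsI.
  - by move=> H /andP[].
have sFG : F \subset G by apply/bigcapsP => H /andP[_ /andP[]].
have Ge : e \in G by apply/bigcapP => H /andP[_ /andP[]].
have minG H : H \in om_flats -> F \subset H -> e \in H -> G \subset H.
  by move=> HF sFH He; apply: bigcap_inf; rewrite HF sFH.
have pFG : F \proper G by apply/properP; split=> //; exists e.
exists G; split.
  split=> //; rewrite /flat_covers FF GF pFG /=.
  apply/forall_inP => H HF; apply/negP => /andP[/properP[sFH [f Hf Ff]] pHG].
  have [He|He] := boolP (e \in H).
    by have := minG H HF sFH He; rewrite (negbTE (proper_subn pHG)).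
  have [K KF [sFK Ke /negP[]]] := om_flats_exchange FF HF sFH He Hf Ff.
  by apply: (subsetP (minG K KF sFK Ke)); apply: (subsetP (proper_sub pHG)).
move=> H [/and4P[_ HF pFH /forall_inP minH] He].
have sGH : G \subset H by apply: minG => //; apply: proper_sub.
have := minH G GF; rewrite pFG /= properE sGH /= negbK => sHG.
by apply/eqP; rewrite eqEsubset sGH.
Qed.

Definition underlying : matroid E :=
  Matroid om_flatsT om_flatsI om_flats_cover.

Definition positive_flat (T : signvec E) (F : {set E}) : Prop :=
  exists X, [/\ X \in covectors M, sv_le X T & F = zero_set X].

End Underlying.

(* The ground set E + g of an extension is [option E], with g = [None]. *)

Section Extension.
Variable E : finType.

Definition delete_g (X : signvec (option E)) : signvec E :=
  [ffun e => X (Some e)].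

(* The rank condition is the usual convention for single-element extensions:
   it excludes exactly the case where g is a coloop of N. *)
Definition extension (M : oriented_matroid E)
    (N : oriented_matroid (option E)) : Prop :=
  covectors M = [set delete_g X | X in covectors N] /\
  rank (underlying N) = rank (underlying M).

Definition generic (M : oriented_matroid E)
    (N : oriented_matroid (option E)) : Prop :=
  forall A : {set E},
    rank_of (underlying M) A < rank (underlying M) ->
    None \notin closure (underlying N) [set Some e | e in A].

Variable N : oriented_matroid (option E).

Definition Lg_pos : {set signvec (option E)} :=
  [set X in covectors N | X None == sg_pos].

Definition Lg_pospos : {set signvec (option E)} :=
  [set X in Lg_pos |
     [forall Y in covectors N,
        (sv_le Y X && (Y != sv_zero _)) ==> (Y None == sg_pos)]].

Definition bounded_topes_ext : {set signvec (option E)} :=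
  [set X in Lg_pospos | [forall Y in Lg_pospos, sv_le X Y ==> (Y == X)]].

Definition bounded_topes : {set signvec E} :=
  [set delete_g X | X in bounded_topes_ext].

End Extension.

From mathcomp Require Import boolp classical_sets reals.

Section Bergman.
Variables (R : realType) (E : finType).
Local Open Scope ring_scope.
Implicit Type w : {ffun E -> R}.

Definition unit_sphere w : Prop :=
  \sum_e w e = 0 /\ \sum_e w e ^+ 2 = 1.

(* [Fs] lists F_1, ..., F_(k+1), and [chain_block Fs i] is F_(i+1) \ F_i. *)
Definition chain_block (Fs : seq {set E}) (i : nat) : {set E} :=
  nth finset.set0 Fs i :\: nth finset.set0 (finset.set0 :: Fs) i.

Definition weight_chain w (Fs : seq {set E}) : Prop :=
  [/\ path (fun F G : {set E} => F \proper G) finset.set0 Fs,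
      last finset.set0 Fs = finset.setT,
      forall i e f, (i < size Fs)%N ->
        e \in chain_block Fs i -> f \in chain_block Fs i -> w e = w f
    & forall i j e f, (i < j < size Fs)%N ->
        e \in chain_block Fs i -> f \in chain_block Fs j -> w e < w f].

Definition bergman (M : matroid E) : set {ffun E -> R} :=
  fun w => unit_sphere w /\
    exists2 Fs, weight_chain w Fs &
      forall F, F \in finset.set0 :: Fs -> F \in flats M.

Definition positive_bergman (M : oriented_matroid E) (T : signvec E) :
    set {ffun E -> R} :=
  fun w => unit_sphere w /\
    exists2 Fs, weight_chain w Fs &
      forall F, F \in finset.set0 :: Fs -> positive_flat M T F.

End Bergman.

Arguments bergman R {E} M.
Arguments positive_bergman R {E} M T.

(* Main.v *)
From mathcomp Require Import all_boot all_order all_algebra.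
Require Import Defs.

(** Genericity of [g] makes an unbounded covector [X] with [X_g = +] agree on
    [E] with its face at infinity, so [X] is bounded iff replacing [X_g] by [0]
    does not give a covector of [N].

    Flags: if [X] is bounded with zero set [F] and the flat [F] covers [F'],
    choose [Y] with zero set [F']; were both [X o Y] and [X o -Y] unbounded,
    eliminating an element of [F \ F'] between their faces at infinity would
    put [X], with [X_g] replaced by [0], in [N]. Hence every flag of flats is
    the flag of zero sets of faces of some bounded tope.

    Counting: for every set [F], the sum of [(-1)^rank(z(X))] over the covectors
    [X] with [F] contained in the zero set [z(X)] is [(-1)^rank(F)]. Applied to
    [F] and to [F + g], this shows that the sum over the bounded [X] alone is
    the same constant [-(-1)^r] for all flats [F <> E], and Moebius inversion
    gives the number of bounded topes. *)

Set Implicit Arguments.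
Unset Strict Implicit.
Unset Printing Implicit Defensive.
Import Order.TTheory GRing.Theory Num.Theory.

(** * Closure, bases, rank and Moebius sums in a matroid given by its flats *)

Section MatroidRank.
Variables (E : finType) (M : matroid E).
Implicit Types (A B F I J : {set E}).

Lemma closure_flat A : closure M A \in flats M.
Proof.
apply: (big_ind (fun H => H \in flats M)); [exact: flatsT| exact: flatsI|].
by move=> F /andP[].
Qed.

Lemma sub_closure A : A \subset closure M A.
Proof. by apply/bigcapsP => F /andP[]. Qed.

Lemma closure_min A F : F \in flats M -> A \subset F -> closure M A \subset F.
Proof. by move=> FF sAF; apply: bigcap_inf; rewrite FF. Qed.

Lemma closure_sub A B : A \subset closure M B -> closure M A \subset closure M B.
Proof. exact/closure_min/closure_flat. Qed.

Lemma closureS A B : A \subset B -> closure M A \subset closure M B.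
Proof. by move=> sAB; apply: closure_sub; apply: subset_trans (sub_closure B). Qed.

Lemma closure_id F : F \in flats M -> closure M F = F.
Proof. by move=> FF; apply/eqP; rewrite eqEsubset closure_min // sub_closure. Qed.

Lemma notin_closureP A e :
  reflect (exists2 F, F \in flats M & A \subset F /\ e \notin F)
          (e \notin closure M A).
Proof.
apply: (iffP idP) => [nAe|[F FF [sAF nFe]]].
  exists (closure M A); [exact: closure_flat | split=> //; exact: sub_closure].
by apply: contra nFe; apply: (subsetP (closure_min FF sAF)).
Qed.

(** The flat covering [closure M A] through [f] contains [e]. It therefore contains
    [closure M (e |: A)], which lies strictly above [closure M A], and so the two are equal. *)
Lemma closure_exchange A e f :
  e \in closure M (f |: A) -> e \notin closure M A -> f \in closure M (e |: A).
Proof.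
move=> efA neA; set F := closure M A in neA *.
have FF : F \in flats M := closure_flat A.
have sF x : F \subset closure M (x |: A) by apply/closureS/subsetUr.
have [fF|nfF] := boolP (f \in F); first exact: (subsetP (sF e)).
have [G [[/and4P[_ GF pFG /forall_inP coverG] fG] _]] := flats_cover FF nfF.
have sAG : A \subset G := subset_trans (sub_closure A) (proper_sub pFG).
have eG : e \in G.
  by apply: subsetP efA; apply: closure_min => //; rewrite subUset sub1set fG.
have := coverG _ (closure_flat (e |: A)).
rewrite properE sF /= properE (closure_min GF) ?subUset ?sub1set ?eG //=.
rewrite negb_and !negbK => /orP[sub|/subsetP/(_ _ fG)//].
case/negP: neA; apply: (subsetP sub); apply: (subsetP (sub_closure _)).
exact: setU11.
Qed.

Lemma indepS I J : I \subset J -> indep M J -> indep M I.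
Proof.
move=> sIJ /forall_inP iJ; apply/forall_inP => a aI.
apply: contra (iJ a (subsetP sIJ a aI)); apply: subsetP.
exact/closureS/setSD.
Qed.

Lemma indepU1 I e : indep M I -> e \notin closure M I -> indep M (e |: I).
Proof.
move=> iI neI; have eI : e \notin I by apply: contra neI; apply/subsetP/sub_closure.
apply/forall_inP => a /setU1P[->|aI]; first by rewrite setU1K.
have nea : e != a by apply: contraNneq eI => ->.
have -> : (e |: I) :\ a = e |: (I :\ a).
  apply/setP => x; rewrite !inE; case: (eqVneq x e) => [->|]; rewrite ?nea //.
apply/negP => /closure_exchange/(_ (forall_inP iI a aI)).
by rewrite setD1K // (negbTE neI).
Qed.

(** Steinitz exchange: an element of [J] outside [I] is traded for one of [I], which preserves
    [#|J|] and shrinks [J :\: I]. *)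
Lemma indep_le_card I J :
  indep M J -> J \subset closure M I -> #|J| <= #|I|.
Proof.
have [k] := ubnP #|J :\: I|; elim: k J => // k IHk J ltk iJ sJI.
have [sub|/subsetPn[j jJ njI]] := boolP (J \subset I); first exact: subset_leq_card.
have njJ := forall_inP iJ j jJ.
(* If [J :\ j] spanned [I], it would span [J] and in particular [j], against independence. *)
have [sI|/subsetPn[i iI niJ]] := boolP (I \subset closure M (J :\ j)).
  by case/negP: njJ; apply: (subsetP (closure_sub sI)); apply: (subsetP sJI).
have niJ' : i \notin J :\ j by apply: contra niJ; apply/subsetP/sub_closure.
have -> : #|J| = #|i |: (J :\ j)| by rewrite cardsU1 niJ' [LHS](cardsD1 j) jJ.
apply: IHk.
- rewrite -ltnS; apply: leq_trans ltk; rewrite ltnS.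
  apply: proper_card; apply/properP; split; last first.
    exists j; first by rewrite inE njI.
    by rewrite !inE eqxx orbF njI; apply: contraNneq njI => ->.
  apply/subsetP => x; rewrite !inE.
  by case: eqP => [->|_]; rewrite ?iI //= => /andP[-> /andP[]].
- by apply: indepU1 => //; apply: indepS iJ; apply: subsetDl.
- rewrite subUset sub1set (subsetP (sub_closure I)) //=.
  exact: subset_trans (subsetDl _ _) sJI.
Qed.

Lemma rank_of_basis A I :
  I \subset A -> indep M I -> A \subset closure M I -> rank_of M A = #|I|.
Proof.
move=> sIA iI sAI; apply/eqP; rewrite eqn_leq; apply/andP; split.
  apply/bigmax_leqP => J /andP[sJA iJ]; apply: indep_le_card => //.
  exact: subset_trans sAI.
by apply: (leq_bigmax_cond (P := fun J => (J \subset A) && indep M J)); rewrite sIA.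
Qed.

Lemma basis_exists A :
  exists I : {set E}, [/\ I \subset A, indep M I & A \subset closure M I].
Proof.
have i0 : (set0 \subset A) && indep M set0.
  by rewrite sub0set; apply/forall_inP => a; rewrite inE.
pose P I := (I \subset A) && indep M I.
case: (@arg_maxnP _ set0 P (fun I => #|I|) i0) => I /andP[sIA iI] maxI.
exists I; split=> //; apply/subsetP => a aA; apply: contraT => naI.
have := maxI (a |: I); rewrite /P subUset sub1set aA sIA indepU1 //= => /(_ isT).
rewrite cardsU1 (contra (subsetP (sub_closure I) a)) //=.
by rewrite add1n /= leqNgt ltnSn.
Qed.

Lemma rank_ofU1 A e :
  rank_of M (e |: A) = rank_of M A + (e \notin closure M A).
Proof.
have [I [sIA iI sAI]] := basis_exists A.
have sAI' : closure M A \subset closure M I := closure_sub sAI.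
rewrite (rank_of_basis sIA iI sAI).
have [eA|neA] /= := boolP (e \in closure M A).
  rewrite addn0; apply: rank_of_basis => //.
    exact: subset_trans sIA (subsetUr _ _).
  by rewrite subUset sub1set sAI (subsetP sAI').
have neI : e \notin closure M I by apply: contra neA; apply/subsetP/closureS.
have := @rank_of_basis (e |: A) (e |: I); rewrite cardsU1.
rewrite (contra (subsetP (sub_closure I) e)) //= addn1 add1n; apply.
- exact: setUS.
- exact: indepU1.
- rewrite subUset sub1set (subsetP (sub_closure _)) ?setU11 //=.
  apply: subset_trans sAI _; exact/closureS/subsetUr.
Qed.

Lemma rank_ofS A B : A \subset B -> rank_of M A <= rank_of M B.
Proof.
move=> sAB; have [I [sIA iI sAI]] := basis_exists A.
rewrite (rank_of_basis sIA iI sAI).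
apply: (leq_bigmax_cond (P := fun J => (J \subset B) && indep M J)).
by rewrite iI (subset_trans sIA).
Qed.

Lemma rank_of_flat_lt F :
  F \in flats M -> F != setT -> rank_of M F < rank M.
Proof.
move=> FF; rewrite -subTset => /subsetPn[e _ neF].
have := rank_ofU1 F e; rewrite closure_id // neF addn1 => <-.
exact/rank_ofS/subsetT.
Qed.

Lemma flat_covers_below (F G : {set E}) :
  F \in flats M -> G \in flats M -> F \proper G ->
  exists2 H, flat_covers (flats M) H G & F \subset H.
Proof.
move=> FF GF pFG.
have P0 : [&& F \in flats M, F \subset F & F \proper G] by rewrite FF pFG subxx.
pose P H := [&& H \in flats M, F \subset H & H \proper G].
case: (@arg_maxnP _ F P (fun H => #|H|) P0) => H /and3P[HF sFH pHG] maxH.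
exists H => //; rewrite /flat_covers HF GF pHG /=.
apply/forall_inP => K KF; apply/negP => /andP[pHK pKG].
have := maxH K; rewrite /P KF pKG (subset_trans sFH (proper_sub pHK)) => /(_ isT).
by rewrite /= leqNgt proper_card.
Qed.

(** This is the recursion [mobiusE] with all terms on one side; [closure M set0] is the least
    flat. *)
Lemma sum_mobius_below (G : {set E}) : G \in flats M ->
  (\sum_(F in flats M | F \subset G) mobius M (closure M set0) F)%R =
  ((G == closure M set0)%:R : int)%R.
Proof.
move=> GF; set O := closure M set0.
have sOF F : F \in flats M -> O \subset F.
  by move=> FF; apply: closure_min; rewrite ?sub0set.
rewrite (bigD1 G) ?GF ?subxx //= mobiusE eq_sym.
have [->|nGO] := eqVneq G O.
  rewrite big1 ?addr0 // => F /andP[/andP[FF sFO] /negP[]].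
  by rewrite eqEsubset sFO sOF.
rewrite properEneq eq_sym nGO sOF //= addrC; apply/eqP; rewrite subr_eq0; apply/eqP.
apply: eq_bigl => F; rewrite properEneq; case FF: (F \in flats M) => //=.
by rewrite sOF //= andbC.
Qed.

End MatroidRank.

(** * Sign vectors: restriction, change of one entry, faces, zero sets *)

Section SignVectorTheory.
Variable E : finType.
Implicit Types (X Y Z : signvec E) (S A : {set E}).

Definition sv_restr S X : signvec E :=
  [ffun e => if e \in S then X e else sg_zero].

Definition sv_set X (e : E) (s : option bool) : signvec E :=
  [ffun x => if x == e then s else X x].

Lemma sub_zero_setP A X :
  reflect {in A, forall e, X e = sg_zero} (A \subset zero_set X).
Proof.
apply: (iffP subsetP) => h e /h; first by rewrite inE => /eqP.
by move=> He; rewrite inE He.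
Qed.

Lemma sv_leP Y X :
  reflect (forall e, Y e != sg_zero -> Y e = X e) (sv_le Y X).
Proof.
apply: (iffP forallP) => h e.
  by move=> Ye; have := h e; rewrite (negbTE Ye) => /eqP.
by case: eqVneq => //= /h ->.
Qed.

Lemma sv_le_trans Y X Z : sv_le X Y -> sv_le Y Z -> sv_le X Z.
Proof.
move=> /sv_leP leXY /sv_leP leYZ; apply/sv_leP => e Xe.
by rewrite -leYZ -leXY.
Qed.

Lemma sv_le_refl X : sv_le X X.
Proof. exact/sv_leP. Qed.

Lemma sv_le_comp X Y : sv_le X (sv_comp X Y).
Proof. by apply/sv_leP => e Xe; rewrite ffunE (negbTE Xe). Qed.

Lemma sv_oppK X : sv_opp (sv_opp X) = X.
Proof. by apply/ffunP => e; rewrite !ffunE; case: (X e) => [[]|]. Qed.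

Lemma zero_set_opp X : zero_set (sv_opp X) = zero_set X.
Proof. by apply/setP => e; rewrite !inE ffunE; case: (X e). Qed.

Lemma zero_set_comp X Y : zero_set (sv_comp X Y) = zero_set X :&: zero_set Y.
Proof. by apply/setP => e; rewrite !inE ffunE; case: (X e). Qed.

Lemma zero_setT X : (zero_set X == setT) = (X == sv_zero E).
Proof.
apply/eqP/eqP => [zX|->]; last by apply/setP => e; rewrite !inE ffunE.
apply/ffunP => e; rewrite ffunE; apply/eqP.
by have := in_setT e; rewrite -zX inE.
Qed.

End SignVectorTheory.

(** * An Euler relation for the covectors of an oriented matroid *)

Section Euler.
Variables (E : finType) (L : oriented_matroid E).
Implicit Types (X Y Z V : signvec E) (F S A : {set E}).

Local Notation cl := (closure (underlying L)).

Lemma notin_om_closureP A e :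
  reflect (exists2 V, V \in covectors L & A \subset zero_set V /\ V e != sg_zero)
          (e \notin cl A).
Proof.
apply: (iffP (notin_closureP _ _ _)) => [[F /imsetP[V LV ->]]|[V LV]].
  by rewrite inE; exists V.
by move=> [sAV Ve]; exists (zero_set V); [exact: imset_f | rewrite inE].
Qed.

Lemma notin_om_closure_sign A e b :
  e \notin cl A ->
  exists2 V, V \in covectors L & A \subset zero_set V /\ V e = Some b.
Proof.
move=> /notin_om_closureP[V LV [sAV]]; case Ve: (V e) => [c|//] _.
have [<-|neq] := eqVneq c b; first by exists V.
exists (sv_opp V); first exact: covectorsN.
by rewrite zero_set_opp ffunE Ve; split=> //=; case: c b neq {Ve} => [] [].
Qed.

Definition rank_sign A : int := ((-1) ^+ rank_of (underlying L) A)%R.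

Lemma rank_signU1 A e :
  rank_sign (e |: A) = (if e \in cl A then rank_sign A else - rank_sign A)%R.
Proof.
rewrite /rank_sign rank_ofU1 exprD; case: (e \in cl A); first by rewrite mulr1.
by rewrite mulrN1.
Qed.

Definition covectors_over F : {set signvec E} :=
  [set X in covectors L | F \subset zero_set X].

(** No element of [F] separates [X] and [Y], so elimination keeps the entries on [F] at 0. *)
Lemma covectors_over_elim F X Y e :
  X \in covectors_over F -> Y \in covectors_over F -> e \in sv_sep X Y ->
  exists Z, [/\ Z \in covectors_over F, Z e = sg_zero &
                forall f, f \notin sv_sep X Y -> Z f = sv_comp X Y f].
Proof.
rewrite !inE => /andP[LX /sub_zero_setP FX] /andP[LY /sub_zero_setP FY] eS.
have [|Z [LZ Ze ZE]] := covectors_elim LX LY (e := e); first by rewrite inE.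
exists Z; split=> //; rewrite inE LZ; apply/sub_zero_setP => f Ff.
by rewrite ZE ?ffunE ?FX ?FY // inE FX.
Qed.

(* Enlarging S by e, a restricted covector Y that vanishes exactly on A extends
   by the sign 0 only if e is in the closure of A, and otherwise either by
   exactly one nonzero sign or by all three signs. The contribution of Y does
   not change, as 2 (-1)^k + (-1)^(k+1) = (-1)^k in the last case. *)
Lemma euler_restr F S :
  (\sum_(Y in sv_restr S @: covectors_over F)
      rank_sign (F :|: (zero_set Y :&: S)) = rank_sign F)%R.
Proof.
have [k] := ubnP #|S|; elim: k S => // k IHk S leS.
have [->|[e eS]] := set_0Vmem S.
  have -> : sv_restr set0 @: covectors_over F = [set sv_zero E].
    apply/setP => Y; rewrite inE; apply/imsetP/eqP => [[X _ ->]|->].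
      by apply/ffunP => e; rewrite !ffunE inE.
    exists (sv_zero E).
      rewrite inE covectors0; apply/sub_zero_setP => e _; exact: ffunE.
    by apply/ffunP => e; rewrite !ffunE inE.
  by rewrite big_set1 setI0 setU0.
pose S' := S :\ e.
have eS' : e \notin S' by rewrite !inE eqxx.
have S'E x : (x \in S') = (x != e) && (x \in S) by rewrite !inE.
rewrite -(IHk S'); last by move: leS; rewrite (cardsD1 e) eS.
(* Group the restrictions to [S] by their restriction [Y] to [S']; the members of a group differ
   only in the sign at [e]. *)
rewrite (partition_big (sv_restr S') (mem (sv_restr S' @: covectors_over F))) /=.
  apply: eq_bigr => Y /imsetP[Z0 FZ0 defY].
  have YE x : Y x = if x \in S' then Z0 x else sg_zero by rewrite defY ffunE.
  set A := F :|: _; set LS := sv_restr S @: _.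
  rewrite (reindex_onto (sv_set Y e) (fun X => X e)); last first.
    move=> X /andP[/imsetP[Z _ ->] /eqP <-]; apply/ffunP => x.
    by rewrite !ffunE; case: eqVneq => [->|nxe] //; rewrite S'E nxe; case: (x \in S).
  have memLS s : reflect (exists2 Z, Z \in covectors_over F &
                            {in S', Z =1 Y} /\ Z e = s)
                         (sv_set Y e s \in LS).
    apply: (iffP imsetP) => [[Z FZ eqZ]|[Z FZ [eqZ Ze]]]; exists Z => //.
      split=> [x|]; last by have /ffunP/(_ e) := eqZ; rewrite !ffunE eqxx eS.
      have /ffunP/(_ x) := eqZ; rewrite !ffunE S'E.
      by case: eqP => //= _ + xS; rewrite xS.
    apply/ffunP => x; rewrite !ffunE; case: eqVneq => [->|nxe].
      by rewrite eS.
    by case: ifP => xS; [rewrite eqZ // S'E nxe | rewrite YE S'E nxe xS].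
  rewrite (eq_bigl (fun s => sv_set Y e s \in LS)); last first.
    move=> s; rewrite ffunE eqxx eqxx andbT andb_idr // => _.
    apply/eqP/ffunP => x; rewrite !ffunE S'E YE S'E.
    by case: eqVneq => //= _; case: (x \in S).
  rewrite (eq_bigr (fun s => rank_sign (if s is None then e |: A else A))); last first.
    move=> s _; congr rank_sign; apply/setP => x.
    have zx : (x \in F :|: (zero_set (sv_set Y e s) :&: S)) =
        (x \in F) || ((if x == e then s else Y x) == sg_zero) && (x \in S).
      by rewrite !inE ffunE.
    rewrite {}zx /A; case: s => [b|]; rewrite !inE; case: (eqVneq x e) => [->|//] /=.
    + by rewrite andbF.
    + by rewrite eS orbT.
  have AV Z : A \subset zero_set Z -> Z \in covectors L -> Z \in covectors_over F.
    by move=> sAZ LZ; rewrite inE LZ (subset_trans _ sAZ) // subsetUl.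
  have ZA Z : Z \in covectors_over F -> {in S', Z =1 Y} -> A \subset zero_set Z.
    rewrite inE => /andP[_ sFZ] eqZ; rewrite subUset sFZ; apply/sub_zero_setP => x.
    by rewrite !inE => /and3P[/eqP Yx nxe xS]; rewrite eqZ ?S'E ?nxe.
  have Z0Y : {in S', Z0 =1 Y} by move=> x xS; rewrite YE xS.
  rewrite big_mkcond (bigD1 None) //= (bigD1 (Some true)) //=.
  rewrite (bigD1 (Some false)) //= big1 => [|[[]|]] //; rewrite addr0 rank_signU1.
  have [eA|neA] := boolP (e \in cl A).
    have ZeN Z : Z \in covectors_over F -> {in S', Z =1 Y} -> Z e = None.
      move=> FZ eqZ; apply/eqP; apply: contraLR eA => Ze.
      apply/notin_om_closureP; exists Z; last by split=> //; apply: ZA.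
      by move: FZ; rewrite inE => /andP[].
    have -> : sv_set Y e None \in LS.
      by apply/memLS; exists Z0 => //; split=> //; apply: ZeN.
    have nS b : sv_set Y e (Some b) \in LS = false.
      by apply/negP => /memLS[Z FZ [eqZ]]; rewrite ZeN.
    by rewrite !nS !addr0.
  have [/memLS[Z FZ [eqZ Ze]]|noN] := boolP (sv_set Y e None \in LS).
    (* Composing [Z], which is 0 at [e], with a covector that vanishes on [A] and has sign [b] at
       [e] produces that sign without changing the entries on [S']. *)
    have pS b : sv_set Y e (Some b) \in LS.
      have [V LV [sAV Ve]] := notin_om_closure_sign b neA.
      apply/memLS; exists (sv_comp Z V).
        apply: AV; first by rewrite zero_set_comp subsetI sAV ZA.
        by apply: covectors_comp => //; move: FZ; rewrite inE => /andP[].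
      split=> [x xS|]; last by rewrite ffunE Ze.
      rewrite ffunE; case: eqP => [Zx|_]; last exact: eqZ.
      rewrite -eqZ // Zx; apply: (sub_zero_setP _ _ sAV).
      by apply/setUP; right; rewrite inE xS inE -eqZ // Zx.
    by rewrite !pS addrA addNr add0r.
  (* If both signs occurred, eliminating [e] would produce the excluded sign 0. *)
  have uniqS b : sv_set Y e (Some b) \in LS -> sv_set Y e (Some (~~ b)) \in LS = false.
    move=> /memLS[Z FZ [eqZ Ze]]; apply/negP => /memLS[Z' FZ' [eqZ' Ze']].
    have [|W [FW We WE]] := covectors_over_elim FZ FZ' (e := e).
      by rewrite inE Ze Ze' /= negbK eqxx.
    case/negP: noN; apply/memLS; exists W => //; split=> // x xS.
    rewrite WE ?ffunE ?eqZ ?eqZ' //; first by case: eqP.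
    by rewrite inE eqZ // eqZ' //; case: (Y x) => [[]|].
  have : (sv_set Y e (Some true) \in LS) || (sv_set Y e (Some false) \in LS).
    case Z0e: (Z0 e) => [b|]; last first.
      by case/negP: noN; apply/memLS; exists Z0.
    have : sv_set Y e (Some b) \in LS by apply/memLS; exists Z0.
    by case: b {Z0e} => -> //; rewrite orbT.
  rewrite add0r => /orP[] h; rewrite h; have := uniqS _ h; rewrite /= => ->.
    by rewrite addr0.
  by rewrite add0r.
move=> Y /imsetP[Z FZ ->]; apply/imsetP; exists Z => //.
by apply/ffunP => x; rewrite !ffunE S'E; case: eqP; case: (x \in S).
Qed.

Lemma euler F :
  (\sum_(X in covectors L | F \subset zero_set X) rank_sign (zero_set X) =
   rank_sign F)%R.
Proof.
rewrite -(euler_restr F setT).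
have restrT X : sv_restr setT X = X by apply/ffunP => e; rewrite ffunE inE.
rewrite (eq_imset (g := id)) // imset_id.
rewrite (eq_bigl (mem (covectors_over F))) => [|X]; last by rewrite /= [RHS]inE.
apply: eq_bigr => X; rewrite [X in is_true X -> _]inE => /andP[_ FX].
by rewrite setIT (setUidPr FX).
Qed.

End Euler.

(** * Covectors of the generic extension [N] and flats of [M] *)

Section GenericExtension.
Variables (E : finType) (M : oriented_matroid E) (N : oriented_matroid (option E)).
Hypotheses (extN : extension M N) (genN : generic M N).
Implicit Types (X Y Z V W : signvec (option E)) (F G A : {set E}).

Local Notation clN := (closure (underlying N)).
Local Notation flatsM := (flats (underlying M)).
Local Notation lift A := [set Some e | e in A].
Local Notation zg X := (zero_set (delete_g X)).

Lemma lift_sub_zero_set A X : (lift A \subset zero_set X) = (A \subset zg X).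
Proof.
apply/subsetP/subsetP => h.
  by move=> e eA; have := h (Some e); rewrite imset_f // !inE ffunE => ->.
by move=> _ /imsetP[e eA ->]; have := h e eA; rewrite !inE ffunE.
Qed.

Lemma zero_set_lift X : X None != sg_zero -> zero_set X = lift (zg X).
Proof.
move=> Xg; apply/eqP; rewrite eqEsubset lift_sub_zero_set subxx andbT.
apply/subsetP => -[e|]; rewrite inE; last by rewrite (negbTE Xg).
by move=> Xe; apply: imset_f; rewrite inE ffunE.
Qed.

Lemma delete_covector X : X \in covectors N -> delete_g X \in covectors M.
Proof. by move=> NX; rewrite (proj1 extN) imset_f. Qed.

Lemma zg_flat X : X \in covectors N -> zg X \in flatsM.
Proof. by move=> NX; apply/imset_f/delete_covector. Qed.

Lemma flat_zg F : F \in flatsM -> exists2 X, X \in covectors N & F = zg X.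
Proof.
case/imsetP => X; rewrite (proj1 extN) => /imsetP[X' NX' ->] ->.
by exists X'.
Qed.

(* The equality of ranks says that g is not a coloop of N. *)
Lemma zg_full X : X \in covectors N -> zg X = setT -> X = sv_zero _.
Proof.
move=> NX zX; apply/eqP; apply: contraT => nX0.
have Xe e : X (Some e) = sg_zero.
  by have := in_setT e; rewrite -zX inE ffunE => /eqP.
have Xg : X None != sg_zero.
  by apply: contra nX0 => /eqP Xg; apply/eqP/ffunP => -[e|]; rewrite ffunE.
(* As [X] is nonzero only at [g], a basis [I] of [M] together with [g] would be independent in [N],
   making the rank of [N] exceed that of [M]. *)
have [I [_ iI sI]] := basis_exists (underlying M) setT.
have iI' : indep (underlying N) (lift I).
  apply/forall_inP => _ /imsetP[a aI ->].
  have /notin_om_closureP[V] := forall_inP iI a aI.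
  rewrite (proj1 extN) => /imsetP[W NW ->] [sIW Wa].
  apply/notin_om_closureP; exists W => //; split; last by move: Wa; rewrite ffunE.
  rewrite -lift_sub_zero_set in sIW; apply: subset_trans sIW.
  apply/subsetP => x /setD1P[nea /imsetP[b bI eqb]]; move: nea; rewrite {}eqb => nea.
  by apply: imset_f; rewrite !inE bI andbT; apply: contraNneq nea => ->.
have gI : None \notin clN (lift I).
  apply/notin_om_closureP; exists X => //; split=> //.
  by rewrite lift_sub_zero_set zX subsetT.
have gI' : None \notin lift I by apply/imsetP => -[].
have := rank_of_basis (subxx _) (indepU1 iI' gI) (sub_closure _ _).
rewrite cardsU1 gI' card_imset; last exact: Some_inj.
move=> rkJ; have := rank_ofS (underlying N) (subsetT (None |: lift I)).
rewrite rkJ -/(rank _) (proj2 extN) /rank (rank_of_basis (subsetT I) iI sI).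
by rewrite add1n ltnn.
Qed.

Lemma g_notin_closure F : F \in flatsM -> F != setT -> None \notin clN (lift F).
Proof. by move=> FF nFT; apply/genN/rank_of_flat_lt. Qed.

(** [sv_comp X V] agrees with [X] on [E]; so a nonzero covector that is 0 at [g] can be given either
    sign at [g] with its other entries unchanged. *)
Lemma generic_covector X b : X \in covectors N -> X != sv_zero _ ->
  exists2 V, V \in covectors N & zg X \subset zg V /\ V None = Some b.
Proof.
move=> NX nX0.
have nT : zg X != setT by apply: contra nX0 => /eqP/(zg_full NX) ->.
have [V NV [sV Vg]] := notin_om_closure_sign b (g_notin_closure (zg_flat NX) nT).
by exists V => //; rewrite -lift_sub_zero_set.
Qed.

(** * Bounded covectors: existence, extension and flags *)

Lemma Lg_posP X :
  reflect (X \in covectors N /\ X None = sg_pos) (X \in Lg_pos N).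
Proof. by rewrite inE; apply: (iffP andP) => -[NX /eqP]. Qed.

Lemma sv_setg0 X : sv_set X None sg_zero None = sg_zero.
Proof. by rewrite ffunE. Qed.

Lemma delete_sv_setg X s : delete_g (sv_set X None s) = delete_g X.
Proof. by apply/ffunP => e; rewrite !ffunE. Qed.

Lemma delete_comp X Y : delete_g (sv_comp X Y) = sv_comp (delete_g X) (delete_g Y).
Proof. by apply/ffunP => e; rewrite !ffunE. Qed.

Lemma delete_opp X : delete_g (sv_opp X) = sv_opp (delete_g X).
Proof. by apply/ffunP => e; rewrite !ffunE. Qed.

(* Genericity leaves no room for a face at infinity of smaller dimension: the
   face at infinity of an unbounded covector has the same entries on E. *)
Lemma boundedE X : X \in Lg_pos N ->
  (X \in Lg_pospos N) = (sv_set X None sg_zero \notin covectors N).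
Proof.
move=> LX; have /Lg_posP[NX Xg] := LX; rewrite inE LX /=.
apply/idP/idP => [/forall_inP bX|nX].
  apply/negP => NX0; have := bX _ NX0; rewrite sv_setg0 implybF => /negP[].
  apply/andP; split.
    by apply/forallP => -[e|]; rewrite ffunE /= ?eqxx ?orbT.
  apply/eqP => /(congr1 (@delete_g E)); rewrite delete_sv_setg => zX.
  have := zg_full NX; rewrite zX => X0.
  have /ffunP/(_ None) : X = sv_zero _.
    by apply: X0; apply/setP => e; rewrite !inE !ffunE.
  by rewrite Xg ffunE.
apply/forall_inP => Y NY; apply/implyP => /andP[/sv_leP leYX nY0].
apply: contraT => Yg.
have {}Yg : Y None = sg_zero.
  by apply/eqP; apply: contraNT Yg => /leYX ->; rewrite Xg.
(* On [E], [sv_comp Y V] has the entries of the face [Y] of [X], so only [g] separates it from [X];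
   eliminating [g] yields [X] with [g]-entry 0. *)
have [V NV [/subsetP sYV Vg]] := generic_covector false NY nY0.
have VY e : Y (Some e) = sg_zero -> V (Some e) = sg_zero.
  by move=> Ye; have := sYV e; rewrite !inE !ffunE Ye => /(_ isT)/eqP.
have [|W [NW Wg WE]] := covectors_elim NX (covectors_comp NY NV) (e := None).
  by rewrite inE Xg ffunE Yg Vg.
case/negP: nX; suff -> : sv_set X None sg_zero = W by [].
apply/ffunP => -[e|]; last by rewrite ffunE Wg.
have XYV : X (Some e) = sg_zero -> sv_comp Y V (Some e) = sg_zero.
  move=> Xe; rewrite ffunE; have [Ye|/leYX->//] := eqVneq (Y (Some e)) sg_zero.
  exact: VY.
rewrite ffunE /= WE.
  by rewrite [RHS]ffunE; case: eqP => // /[dup] Xe /XYV ->.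
rewrite inE ffunE; have [Ye|/leYX->] := eqVneq (Y (Some e)) sg_zero.
  by rewrite VY //; case: (X (Some e)).
by case: (X (Some e)) => [[]|].
Qed.

Lemma bounded_pos X : X \in Lg_pospos N -> X \in Lg_pos N.
Proof. by rewrite inE => /andP[]. Qed.

(** The flat [G :&: zg W] lies between [F] and [G] and contains [e], hence it is [G]. *)
Lemma flat_covers_zg F G W e : flat_covers flatsM F G -> W \in covectors N ->
  F \subset zg W -> e \in zg W -> e \in G -> e \notin F -> G \subset zg W.
Proof.
case/and4P => FF GF pFG /forall_inP coverG NW sFW eW eG neF.
have := coverG _ (flatsI GF (zg_flat NW)).
rewrite !properE subsetI sFW (proper_sub pFG) subsetIl subsetI subxx /=.
rewrite negb_and !negbK => /orP[/subsetP sub|//].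
by case/negP: neF; apply: sub; rewrite inE eG.
Qed.

Lemma bounded_extend_cover F X : X \in Lg_pospos N ->
  flat_covers flatsM F (zg X) ->
  exists X', [/\ X' \in Lg_pospos N, sv_le X X' & zg X' = F].
Proof.
move=> BX cov; have LX := bounded_pos BX; have /Lg_posP[NX Xg] := LX.
have /and4P[FF _ pF _] := cov.
have [Y NY FY] := flat_zg FF.
have /properP[sFX [e eX neF]] := pF.
have [|nXY] := boolP (sv_comp X Y \in Lg_pospos N).
  move=> BXY; exists (sv_comp X Y); split=> //; first exact: sv_le_comp.
  by rewrite delete_comp zero_set_comp -FY; apply/setIidPr.
have [|nXY'] := boolP (sv_comp X (sv_opp Y) \in Lg_pospos N).
  move=> BXY; exists (sv_comp X (sv_opp Y)); split=> //; first exact: sv_le_comp.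
  by rewrite delete_comp zero_set_comp delete_opp zero_set_opp -FY; apply/setIidPr.
have NY' := covectorsN NY.
have infty V : V \in covectors N -> sv_comp X V \notin Lg_pospos N ->
    sv_set (sv_comp X V) None sg_zero \in covectors N.
  move=> NV; rewrite boundedE ?negbK //; apply/Lg_posP; split.
    exact: covectors_comp.
  by rewrite ffunE Xg.
have Xe : X (Some e) = sg_zero by move: eX; rewrite inE ffunE => /eqP.
have Ye : Y (Some e) != sg_zero by move: neF; rewrite FY inE ffunE.
have [|W [NW We WE]] := covectors_elim (infty _ NY nXY) (infty _ NY' nXY') (e := Some e).
  by rewrite inE !ffunE /= Xe eqxx Ye; case: (Y (Some e)) Ye => [[]|].
have WX x : x \notin zg X -> W (Some x) = X (Some x).
  rewrite inE ffunE => Xx; rewrite WE ?inE !ffunE /= (negbTE Xx) ?(negbTE Xx) //.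
  by case: (X (Some x)) Xx => [[]|].
have sFW : F \subset zg W.
  apply/subsetP => x xF; have := subsetP sFX x xF; move: xF.
  rewrite {1}FY !inE !ffunE => /eqP Yx /eqP Xx.
  by rewrite WE ?inE !ffunE /= ?Xx ?Yx.
have eW : e \in zg W by rewrite inE ffunE We.
(* Here the covering is used: [W] vanishes on [F] and at [e], hence on [zg X]. Off [zg X] it equals
   [X], so it is [X] with [g]-entry 0. *)
have /subsetP sXW := flat_covers_zg cov NW sFW eW eX neF.
have Wg : W None = sg_zero by rewrite WE ?inE !ffunE.
move: BX; rewrite boundedE // => /negP[]; suff -> : sv_set X None sg_zero = W by [].
apply/ffunP => -[x|]; rewrite ffunE /= ?Wg //.
have [xX|/WX//] := boolP (x \in zg X).
by have := sXW x xX; move: xX; rewrite !inE !ffunE => /eqP -> /eqP ->.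
Qed.

(** Descends from [zg X] to [F] one cover at a time. *)
Lemma bounded_extend F X : X \in Lg_pospos N -> F \in flatsM -> F \subset zg X ->
  exists X', [/\ X' \in Lg_pospos N, sv_le X X' & zg X' = F].
Proof.
have [k] := ubnP #|zg X|; elim: k X => // k IHk X leX BX FF sFX.
have [->|nFX] := eqVneq F (zg X); first by exists X; rewrite sv_le_refl.
have NX : X \in covectors N by have /Lg_posP[] := bounded_pos BX.
have [|H cov sFH] := flat_covers_below FF (zg_flat NX); first by rewrite properEneq nFX.
have [X1 [BX1 leX1 zX1]] := bounded_extend_cover BX cov.
have [||X2 [BX2 leX2 zX2]] := IHk X1 _ BX1 FF.
- rewrite zX1; case/and4P: cov => _ _ /proper_card ltH _.
  exact: leq_trans ltH _.
- by rewrite zX1.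
by exists X2; split=> //; apply: sv_le_trans leX2.
Qed.

(** A covector positive at [g] and vanishing on a hyperplane [H] above [F] is bounded, since it has
    no proper nonzero face; [bounded_extend] then leads down to [F]. *)
Lemma bounded_exists F : F \in flatsM -> F != setT ->
  exists2 X, X \in Lg_pospos N & zg X = F.
Proof.
move=> FF nFT.
have [|H cov sFH] := flat_covers_below FF (flatsT (underlying M)).
  by rewrite properEneq nFT subsetT.
have /and4P[HF _ pHT _] := cov.
have /properP[_ [e _ neH]] := pHT.
have [V NV [sHV Vg]] := notin_om_closure_sign true (g_notin_closure HF (proper_neq pHT)).
have covT W x : W \in covectors N -> H \subset zg W -> x \notin H ->
    x \in zg W -> W = sv_zero _.
  move=> NW sHW nxH xW; apply: (zg_full NW); apply/eqP; rewrite -subTset.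
  exact: (flat_covers_zg cov NW sHW xW).
rewrite lift_sub_zero_set in sHV.
have nV0 x : x \notin H -> V (Some x) != sg_zero.
  move=> nxH; apply/eqP => Vx; have /ffunP/(_ None) : V = sv_zero _.
    by apply: (covT _ x) => //; rewrite inE ffunE Vx.
  by rewrite Vg ffunE.
have zV : zg V = H.
  apply/eqP; rewrite eqEsubset sHV andbT; apply/subsetP => x.
  by rewrite inE ffunE; apply: contraTT => /nV0.
have BV : V \in Lg_pospos N.
  rewrite boundedE; last exact/Lg_posP.
  apply/negP => NV0.
  (* Elimination between [V] and the opposite of its face at infinity keeps [+] at [g], yet the
     result vanishes on [H] and at [e], so it is zero. *)
  have [|W [NW We WE]] := covectors_elim NV (covectorsN NV0) (e := Some e).
    rewrite inE nV0 // !ffunE /=.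
    by case: (V (Some e)) => [[]|].
  have /ffunP/(_ None) : W = sv_zero _.
    apply: (covT _ e) => //; last by rewrite inE ffunE We.
    apply/subsetP => x xH; have := subsetP sHV x xH.
    by rewrite !inE !ffunE => /eqP Vx; rewrite WE ?inE !ffunE /= Vx.
  by rewrite WE ?inE !ffunE /= Vg.
rewrite -zV in sFH.
by have [X [BX _ zX]] := bounded_extend BV FF sFH; exists X.
Qed.

(** By [bounded_extend] every bounded covector lies below one whose zero set is the least flat, and
    there no entry on [E] can be added. *)
Lemma bounded_topes_extE X :
  (X \in bounded_topes_ext N) =
  (X \in Lg_pospos N) && (zg X == closure (underlying M) set0).
Proof.
rewrite inE; case BX: (X \in Lg_pospos N) => //=.
have NX : X \in covectors N by have /Lg_posP[] := bounded_pos BX.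
have sO Y : Y \in covectors N -> closure (underlying M) set0 \subset zg Y.
  by move=> NY; apply: closure_min; rewrite ?sub0set ?zg_flat.
apply/forall_inP/eqP => [maxX|zX Y BY].
  have [X' [BX' leX zX']] := bounded_extend BX (closure_flat _ set0) (sO X NX).
  by have := maxX X' BX'; rewrite leX -zX' => /eqP ->.
have /Lg_posP[NY Yg] := bounded_pos BY; have /Lg_posP[_ Xg] := bounded_pos BX.
apply/implyP => /sv_leP leXY; apply/eqP/ffunP => -[e|]; last by rewrite Xg.
have [Xe|/leXY//] := eqVneq (X (Some e)) sg_zero.
have := subsetP (sO Y NY) e; rewrite -zX !inE !ffunE Xe => /(_ isT)/eqP.
by [].
Qed.

(** The covector is built from the largest proper flat downwards; faces of the covector at one stage
    remain faces at the next. *)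
Lemma bounded_flag F Fs :
  path (fun F G : {set E} => F \proper G) F Fs -> last F Fs = setT ->
  {subset F :: Fs <= flatsM} -> F != setT ->
  exists2 X, X \in Lg_pospos N & zg X = F /\
    {in F :: Fs, forall G, positive_flat M (delete_g X) G}.
Proof.
have posF X : X \in Lg_pospos N -> positive_flat M (delete_g X) (zg X).
  move=> /bounded_pos/Lg_posP[NX _]; exists (delete_g X); split=> //.
    exact: delete_covector.
  exact: sv_le_refl.
elim: Fs F => [|G Fs IHFs] F /=; first by move=> _ ->; rewrite eqxx.
move=> /andP[pFG pFs] lastFs flF nFT.
have FF : F \in flatsM by apply: flF; rewrite mem_head.
have [GT|nGT] := eqVneq G setT.
  have Fs0 : Fs = [::].
    case: Fs pFs {IHFs lastFs flF} => //= K Fs /andP[].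
    by rewrite GT properE subsetT subTset /=; case: eqP.
  have [X BX zX] := bounded_exists FF nFT.
  exists X => //; split=> // K; rewrite Fs0 !inE => /orP[/eqP ->|/eqP ->].
    by rewrite -zX; apply: posF.
  (* The top flat [E] is not the zero set of a bounded covector, but the zero covector is a face of
     every sign vector. *)
  exists (sv_zero E); split; first exact: covectors0.
    by apply/sv_leP => e; rewrite ffunE.
  by rewrite GT; apply/esym/eqP; rewrite zero_setT.
have [|X BX [zX posX]] := IHFs G pFs lastFs _ nGT.
  by move=> K KFs; apply: flF; rewrite in_cons KFs orbT.
have [|X' [BX' leX zX']] := bounded_extend BX FF; first by rewrite zX proper_sub.
exists X' => //; split=> // K; rewrite in_cons => /orP[/eqP ->|/posX].
  by rewrite -zX'; apply: posF.
case=> Z [MZ leZ ->]; exists Z; split=> //; apply: sv_le_trans leZ _.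
by apply/sv_leP => e; rewrite !ffunE; apply: (sv_leP _ _ leX).
Qed.

(** * Counting the bounded topes *)

Local Open Scope ring_scope.
Local Notation s := (rank_sign N).

(** Unbounded covectors correspond to the nonzero covectors with [g]-entry 0 by changing that entry.
    The zero set loses [g], which flips the rank sign, and the omitted zero covector accounts for
    [s setT]. *)
Lemma sum_unbounded F : F \in flatsM -> F != setT ->
  \sum_(X in Lg_pos N | (F \subset zg X) && (X \notin Lg_pospos N))
     s (zero_set X) = s (lift F) + s setT.
Proof.
move=> FF nFT.
have e0 : \sum_(Y in covectors N | None |: lift F \subset zero_set Y) s (zero_set Y)
          = - s (lift F).
  by rewrite euler rank_signU1 (negbTE (g_notin_closure FF nFT)).
have zsub Y : (None |: lift F \subset zero_set Y) =
    (Y None == sg_zero) && (F \subset zg Y).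
  by rewrite subUset sub1set inE lift_sub_zero_set.
rewrite (bigD1 (sv_zero _)) /= in e0; last first.
  by rewrite covectors0; apply/sub_zero_setP => x _; rewrite ffunE.
have z0 : zero_set (sv_zero (option E)) = setT by apply/eqP; rewrite zero_setT.
have -> : s (lift F) + s setT = - (- s (lift F) - s setT) by rewrite opprD !opprK.
rewrite -{}e0 z0 [s setT + _]addrC addrK.
rewrite (eq_bigl (fun X => [&& X \in Lg_pos N, F \subset zg X &
    sv_set X None sg_zero \in covectors N])); last first.
  by move=> X; case LX: (X \in Lg_pos N); rewrite //= boundedE // negbK.
rewrite (reindex_onto (fun Y => sv_set Y None sg_pos) (fun X => sv_set X None sg_zero)).
  rewrite -sumrN; apply: eq_big => [Y|Y /andP[/and3P[/Lg_posP[NY' _]]]].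
    rewrite zsub.
    have [eqY|neqY] := eqVneq (sv_set (sv_set Y None sg_pos) None sg_zero) Y; last first.
      rewrite andbF; apply/esym/negP => /andP[/and3P[_ /eqP Yg _] _].
      by case/negP: neqY; apply/eqP/ffunP => -[x|]; rewrite !ffunE.
    have Yg : Y None = sg_zero by rewrite -eqY ffunE.
    rewrite andbT Yg eqxx delete_sv_setg eqY /= inE ffunE eqxx andbT.
    case NY: (Y \in covectors N); rewrite ?andbF //= andbT andbC; congr andb.
    apply/idP/idP => [NY'|nY0].
      apply/eqP => Y0; have := zg_full NY'; rewrite delete_sv_setg.
      have -> : zg Y = setT.
        by apply/eqP; rewrite zero_setT Y0; apply/eqP/ffunP => x; rewrite !ffunE.
      by move=> /(_ erefl)/ffunP/(_ None); rewrite !ffunE.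
    (* Genericity makes every nonzero [Y] with [g]-entry 0 the face at infinity of some covector
       positive at [g]. *)
    have [V NV [/subsetP sYV Vg]] := generic_covector true NY nY0.
    suff -> : sv_set Y None sg_pos = sv_comp Y V by apply: covectors_comp.
    apply/ffunP => -[x|]; rewrite !ffunE /= ?Yg ?eqxx ?Vg //.
    case: eqP => // Yx; have := sYV x; rewrite !inE !ffunE Yx.
    by move=> /(_ isT)/eqP.
  rewrite delete_sv_setg => sFY NY /eqP eqY; rewrite eqY in NY.
  have Yg : Y None = sg_zero by rewrite -eqY ffunE.
  have nT : zg Y != setT.
    apply/eqP => zY; have := zg_full NY'; rewrite delete_sv_setg => /(_ zY).
    by move=> /ffunP/(_ None); rewrite !ffunE.
  have -> : zero_set Y = None |: lift (zg Y).
    apply/setP => -[x|]; rewrite !inE ?Yg //= mem_imset ?inE ?ffunE //.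
    exact: Some_inj.
  rewrite rank_signU1 (negbTE (g_notin_closure (zg_flat NY) nT)) opprK.
  by rewrite zero_set_lift ?ffunE // delete_sv_setg.
move=> X /and3P[/Lg_posP[_ Xg] _ _].
by apply/ffunP => -[x|]; rewrite !ffunE.
Qed.

(** Split [euler] for [lift F] by the sign at [g]: sign 0 contributes [- s (lift F)], and [+] and
    [-] contribute equally by negation. Hence twice the sum is twice [s (lift F)]. *)
Lemma sum_pos F : F \in flatsM -> F != setT ->
  \sum_(X in Lg_pos N | F \subset zg X) s (zero_set X) = s (lift F).
Proof.
move=> FF nFT; set P := LHS.
have e0 : \sum_(Y in covectors N | None |: lift F \subset zero_set Y) s (zero_set Y)
          = - s (lift F).
  by rewrite euler rank_signU1 (negbTE (g_notin_closure FF nFT)).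
have opp_sum : \sum_(X in covectors N |
    (lift F \subset zero_set X) && (X None == Some false)) s (zero_set X) = P.
  rewrite (reindex_inj (inv_inj (@sv_oppK _))); apply: eq_big => [X|X _].
    have -> : (sv_opp X \in covectors N) = (X \in covectors N).
      by apply/idP/idP => /covectorsN //; rewrite sv_oppK.
    rewrite zero_set_opp lift_sub_zero_set ffunE inE -andbA; congr andb.
    by rewrite andbC; congr andb; case: (X None) => [[]|].
  by rewrite zero_set_opp.
have := euler N (lift F).
rewrite (bigID (fun X : signvec (option E) => X None == sg_zero)) /=.
rewrite (eq_bigl (fun X => (X \in covectors N) &&
    (None |: lift F \subset zero_set X))); last first.
  by move=> X; rewrite subUset sub1set inE [in RHS]andbC andbC andbA andbAC andbC.
rewrite e0 (bigID (fun X : signvec (option E) => X None == sg_pos)) /=.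
rewrite (eq_bigl (fun X => (X \in Lg_pos N) && (F \subset zg X))); last first.
  move=> X; rewrite inE lift_sub_zero_set.
  by case: (X None) => [[]|]; rewrite /= ?andbF ?andbT.
rewrite -/P (eq_bigl (fun X => (X \in covectors N) &&
    ((lift F \subset zero_set X) && (X None == Some false)))); last first.
  by move=> X; case: (X None) => [[]|]; rewrite /= ?andbF ?andbT.
rewrite opp_sum => /eqP; rewrite addrC subr_eq -!mulr2n => /eqP.
by apply: pmulrnI.
Qed.

Lemma sum_bounded F : F \in flatsM ->
  \sum_(X in Lg_pospos N | F \subset zg X) s (zero_set X) =
  if F == setT then 0 else - s setT.
Proof.
move=> FF; case: eqVneq => [->|nFT].
  apply: big1 => X /andP[/bounded_pos/Lg_posP[NX Xg]]; rewrite subTset => /eqP/(zg_full NX).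
  by move/ffunP/(_ None); rewrite Xg ffunE.
have := sum_pos FF nFT; rewrite (bigID (mem (Lg_pospos N))) /=.
rewrite [X in _ + X](eq_bigl (fun X => (X \in Lg_pos N) &&
  ((F \subset zg X) && (X \notin Lg_pospos N)))) => [|X]; last by rewrite andbA.
rewrite sum_unbounded // => /eqP; rewrite eq_sym -subr_eq opprD addrA subrr sub0r.
move=> /eqP ->; apply: eq_bigl => X; case BX: (X \in Lg_pospos N); rewrite ?andbF //.
by rewrite bounded_pos ?andbT.
Qed.

(** Weight [sum_bounded] at [F] by the Moebius value [m F] and sum over the flats. Exchanging the
    sums leaves only the bounded topes, each with the same sign. *)
Lemma card_bounded_topes :
  (0 < rank (underlying M))%N -> #|bounded_topes N| = absz (mu (underlying M)).
Proof.
move=> rk0; set O := closure (underlying M) set0.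
(* In rank 0 the least flat is [E]: then [mu] is 1, but there is no bounded tope. *)
have nOT : O != setT.
  apply: contraTneq rk0 => OT; rewrite -leqNgt /rank.
  rewrite (@rank_of_basis _ _ _ set0) ?cards0 ?sub0set ?OT //.
    by apply/forall_inP => a; rewrite inE.
  by rewrite -/O OT.
(* Deleting [g] is injective on bounded topes, as all of them have [+] at [g]. *)
rewrite card_in_imset; last first.
  move=> X Y; rewrite !bounded_topes_extE.
  move=> /andP[/bounded_pos/Lg_posP[_ Xg] _] /andP[/bounded_pos/Lg_posP[_ Yg] _].
  move=> /ffunP eqXY; apply/ffunP => -[e|]; last by rewrite Xg.
  by have := eqXY e; rewrite !ffunE.
pose m := mobius (underlying M) O.
have : \sum_(F in flatsM) m F * (\sum_(X in Lg_pospos N | F \subset zg X) s (zero_set X))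
     = s setT * m setT.
  have := sum_mobius_below (flatsT (underlying M)); rewrite -/O eq_sym (negbTE nOT).
  rewrite (eq_bigl (mem flatsM)) => [|F]; last by rewrite subsetT andbT.
  rewrite (bigD1 setT) /=; last exact: om_flatsT.
  move=> /eqP; rewrite addr_eq0 => /eqP mT.
  rewrite (bigD1 setT) /=; last exact: om_flatsT.
  rewrite sum_bounded ?flatsT // eqxx mulr0 add0r.
  rewrite /m mT mulrN -mulNr mulr_sumr; apply: eq_bigr => F /andP[FF nF].
  by rewrite sum_bounded // (negbTE nF) mulrC.
under eq_bigr do rewrite mulr_sumr.
(* For fixed [X] the inner sum runs over the flats below [zg X], so by [sum_mobius_below] it is 1 if
   [zg X] is [O] and 0 otherwise. *)
rewrite (exchange_big_dep (mem (Lg_pospos N))) /=; last by move=> F X _ /andP[].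
rewrite (eq_bigr (fun X => (zg X == O)%:R * s (lift O))); last first.
  move=> X BX; have /Lg_posP[NX Xg] := bounded_pos BX.
  rewrite BX /= -mulr_suml.
  rewrite (sum_mobius_below (zg_flat NX)) -/O.
  case: eqP => [<-|_]; last by rewrite !mul0r.
  by rewrite -zero_set_lift // Xg.
rewrite -mulr_suml => /(congr1 absz); rewrite !abszM !abszX !exp1n muln1 mul1n.
rewrite /mu -/O -/(m setT) => <-.
rewrite -natr_sum natz absz_nat -sum1_card big_mkcond [in RHS]big_mkcond /=.
apply: eq_bigr => X _.
by rewrite bounded_topes_extE; case: (X \in Lg_pospos N) => //=; case: eqP.
Qed.

End GenericExtension.

(* The Bergman complex as a union of positive Bergman complexes *)
From mathcomp Require Import boolp classical_sets reals.

Theorem theorem2p8 (R : realType) (E : finType) (r : nat)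
    (M : oriented_matroid E) (N : oriented_matroid (option E))
    (rkM : rank (underlying M) = r)
    (extN : extension M N) (genN : generic M N) :
  (0 < r -> #|bounded_topes N| = absz (mu (underlying M)))
  /\ (bergman R (underlying M) =
     \bigcup_(T in [set` bounded_topes N]) positive_bergman R M T)%classic.
Proof.
split; first by rewrite -rkM; apply: card_bounded_topes.
apply/seteqP; split=> w.
- case=> sph [Fs chain flatFs].
  have [pathFs lastFs _ _] := chain.
  (* On an empty ground set the sphere is empty, because the sum of squares would be 0. *)
  have nT : finset.set0 != finset.setT :> {set E}.
    apply/eqP => ET; have [_ /eqP] := sph; rewrite big1 => [|e _].
      by rewrite eq_sym oner_eq0.
    by have := finset.in_set0 e; rewrite ET finset.in_setT.
  have [X BX [zX posX]] := bounded_flag extN genN pathFs lastFs flatFs nT.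
  exists (delete_g X); last by split=> //; exists Fs.
  (* The flag starts at the empty set, which is thus the least flat, so [X] is a bounded tope. *)
  apply/imsetP; exists X => //; rewrite (bounded_topes_extE extN genN) BX zX.
  by rewrite closure_id ?eqxx //; apply: flatFs; rewrite mem_head.
- case=> T _ [sph [Fs chain posFs]]; split=> //; exists Fs => // F /posFs.
  by case=> X [MX _ ->]; apply: imset_f.
Qed.
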